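(* Let $(A,\mathcal S,[\cdot,\cdot]_{\mathcal S},\beta)$ be a Leibniz pair with $A$ unital. Then there is an equivalence of categories $$\mathsf{ARep}_{\mathbb K}(\mathcal S)\rightleftarrows\mathsf{Rep}(\mathcal S\otimes_{\mathbb K}A)$$ between the category of admissible representations of the Leibniz pair $\mathcal S$ and the category of representations of the action Lie-Rinehart algebra $\mathcal S\otimes_{\mathbb K}A$. In one direction it is given by the functor $P:\mathsf{ARep}_{\mathbb K}(\mathcal S)\to\mathsf{Rep}(\mathcal S\otimes_{\mathbb K}A)$ with $P(M;\rho)=(M;\overline\rho)$, where $\overline\rho(x\otimes a)=a\rho(x)$ for $x\in\mathcal S$, $a\in A$, and $P(\phi:M\to M')=(\phi:M\to M')$ on morphisms; here every homomorphism $\phi:M\to M'$ of admissible representations satisfies $\phi\circ\overline\rho(x\otimes a)=\overline{\rho'}(x\otimes a)\circ\phi$ for all $x\in\mathcal S$, $a\in A$, and so is a homomorphism of representations of $\mathcal S\otimes_{\mathbb K}A$. In the other direction it is given by sending a representation $(M;\rho)$ of $\mathcal S\otimes_{\mathbb K}A$ to $(M;\widetilde\rho)$, where $\widetilde\rho:\mathcal S\to\mathfrak{gl}_{\mathbb K}(M)$ is defined by $\widetilde\rho(x)=\rho(x\otimes 1)$ for $x\in\mathcal S$, which is made into a functor in the same way (with $\phi\mapsto\phi$ on morphisms).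
   Context: All vector spaces are over an algebraically closed field $\mathbb K$ of characteristic $0$; $A$ is a commutative associative $\mathbb K$-algebra. $\mathrm{Der}_{\mathbb K}(A)$ is the Lie algebra of $\mathbb K$-linear derivations of $A$. A Leibniz pair $(A,\mathcal S,[\cdot,\cdot]_{\mathcal S},\beta)$ consists of a $\mathbb K$-Lie algebra $(\mathcal S,[\cdot,\cdot]_{\mathcal S})$ and a $\mathbb K$-Lie algebra homomorphism $\beta:\mathcal S\to\mathrm{Der}_{\mathbb K}(A)$. An admissible representation $(M;\rho)$ of it is an $A$-module $M$ with a $\mathbb K$-Lie algebra homomorphism $\rho:\mathcal S\to\mathfrak{gl}_{\mathbb K}(M)$ such that $\rho(x)(am)=a\rho(x)m+\beta(x)(a)m$ for all $x\in\mathcal S$, $a\in A$, $m\in M$. A homomorphism of admissible representations $(M;\rho)\to(M';\rho')$ is an $A$-module homomorphism $\phi:M\to M'$ with $\phi\circ\rho(x)=\rho'(x)\circ\phi$ for all $x\in\mathcal S$. The resulting category is $\mathsf{ARep}_{\mathbb K}(\mathcal S)$. A Lie-Rinehart algebra $(A,\mathcal L,[\cdot,\cdot],\alpha)$ is a $\mathbb K$-Lie algebra $\mathcal L$ with an $A$-module structure and a map $\alpha:\mathcal L\to\mathrm{Der}_{\mathbb K}(A)$ that is both a $\mathbb K$-Lie algebra homomorphism and an $A$-module homomorphism, with $[x,ay]=a[x,y]+\alpha(x)(a)y$ for all $x,y\in\mathcal L$, $a\in A$. A representation $(M;\rho)$ of $\mathcal L$ is an $A$-module $M$ with a $\mathbb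 K$-Lie algebra homomorphism $\rho:\mathcal L\to\mathfrak{gl}_{\mathbb K}(M)$ that is also an $A$-module homomorphism (so $\rho(ax)=a\rho(x)$) and satisfies $\rho(x)(am)=a\rho(x)m+\alpha(x)(a)m$ for all $x\in\mathcal L$, $a\in A$, $m\in M$. Morphisms in the category $\mathsf{Rep}(\mathcal L)$ are $A$-module homomorphisms $\phi$ with $\phi\circ\rho(x)=\rho'(x)\circ\phi$ for all $x\in\mathcal L$. The action Lie-Rinehart algebra $(A,\mathcal S\otimes_{\mathbb K}A,[\cdot,\cdot],\alpha)$ of a Leibniz pair is defined by $a(x\otimes b)=x\otimes ab$, $[x\otimes a,y\otimes b]=[x,y]_{\mathcal S}\otimes ab+y\otimes(a\beta(x)b)-x\otimes(b\beta(y)a)$ and $\alpha(x\otimes a)=a\beta(x)$ for all $a,b\in A$, $x,y\in\mathcal S$. *)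

(* Defs.v *)
From HB Require Import structures.
From mathcomp Require Import all_boot all_algebra.
From mathcomp Require Import generic_quotient ssrAC boolp ring.

Set Implicit Arguments.
Unset Strict Implicit.
Unset Printing Implicit Defensive.

Import GRing.Theory.
Local Open Scope ring_scope.
Local Open Scope quotient_scope.

(* A commutative unital K-algebra is a commutative ring with a ring morphism
   from K; unlike [comAlgType], this includes the zero algebra. *)
Record comAlg (K : comPzRingType) := ComAlg {
  alg_ring :> comPzRingType;
  alg_map : {rmorphism K -> alg_ring}
}.

(* The K-module underlying an A-module. *)
Definition restr (K : comPzRingType) (A : comAlg K) (M : lmodType A)
  : Type := M.

Section Restriction.
Variables (K : comPzRingType) (A : comAlg K) (M : lmodType A).
Local Notation rM := (restr M).

HB.instance Definition _ := GRing.Zmodule.on rM.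

Definition restr_scale (k : K) (m : rM) : rM := alg_map A k *: (m : M).

Fact restr_scaleA k l m :
  restr_scale k (restr_scale l m) = restr_scale (k * l) m.
Proof. by rewrite /restr_scale scalerA -rmorphM. Qed.
Fact restr_scale1 : left_id 1 restr_scale.
Proof. by move=> m; rewrite /restr_scale rmorph1 scale1r. Qed.
Fact restr_scaleDr : right_distributive restr_scale +%R.
Proof. by move=> k m n; apply: (@scalerDr A M). Qed.
Fact restr_scaleDl m : {morph restr_scale^~ m : k l / k + l}.
Proof. by move=> k l; rewrite /restr_scale rmorphD; apply: (@scalerDl A M). Qed.

HB.instance Definition _ := GRing.Zmodule_isLmodule.Build K rM
  restr_scaleA restr_scale1 restr_scaleDr restr_scaleDl.
End Restriction.

(* A as a K-module. *)
Notation alg_mod A := (restr (alg_ring A)^o).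

Lemma alg_modZE (K : comPzRingType) (A : comAlg K) (k : K) (a : A) :
  k *: (a : alg_mod A) = alg_map A k * a.
Proof. by []. Qed.

(** Tensor products *)

Section Tensor.
Variables (K : comPzRingType) (V W : lmodType K).

(* A list stands for the formal sum of its entries x (x) y; this is the
   congruence generated by the relations of the tensor product. *)
Inductive tens_eq : seq (V * W) -> seq (V * W) -> Prop :=
| tens_eq_refl s : tens_eq s s
| tens_eq_sym s t : tens_eq s t -> tens_eq t s
| tens_eq_trans s t u : tens_eq s t -> tens_eq t u -> tens_eq s u
| tens_eq_cat s s' t t' :
    tens_eq s s' -> tens_eq t t' -> tens_eq (s ++ t) (s' ++ t')
| tens_eq_catC s t : tens_eq (s ++ t) (t ++ s)
| tens_eqDl x x' y : tens_eq [:: (x + x', y)] [:: (x, y); (x', y)]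
| tens_eqDr x y y' : tens_eq [:: (x, y + y')] [:: (x, y); (x, y')]
| tens_eqZ (k : K) x y : tens_eq [:: (k *: x, y)] [:: (x, k *: y)]
| tens_eq0 : tens_eq [:: (0, 0)] [::].

Definition tens_eqb s t : bool := `[< tens_eq s t >].

Fact tens_eqb_refl : reflexive tens_eqb.
Proof. by move=> s; apply/asboolP/tens_eq_refl. Qed.
Fact tens_eqb_sym : symmetric tens_eqb.
Proof. by move=> s t; apply/asboolP/asboolP => /tens_eq_sym. Qed.
Fact tens_eqb_trans : transitive tens_eqb.
Proof.
by move=> s t u /asboolP e1 /asboolP e2; apply/asboolP/(tens_eq_trans e1 e2).
Qed.

Canonical tens_equiv :=
  EquivRel tens_eqb tens_eqb_refl tens_eqb_sym tens_eqb_trans.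

Definition tensor : Type := {eq_quot tens_equiv}.
HB.instance Definition _ := Choice.on tensor.
HB.instance Definition _ := Quotient.on tensor.

Fact tens_piP s t : \pi_tensor s = \pi_tensor t <-> tens_eq s t.
Proof.
split=> [/eqmodP/asboolP//|e]; exact/eqmodP/asboolP.
Qed.

Fact tens_eq_repr s : tens_eq (repr (\pi_tensor s)) s.
Proof. by apply/tens_piP; rewrite reprK. Qed.

Definition tens_add (u v : tensor) : tensor := \pi_tensor (repr u ++ repr v).
Definition tens_opp (u : tensor) : tensor :=
  \pi_tensor [seq (- p.1, p.2) | p <- repr u].

Fact tens_pi_add s t : tens_add (\pi_tensor s) (\pi_tensor t) = \pi_tensor (s ++ t).
Proof. by apply/tens_piP/tens_eq_cat; apply: tens_eq_repr. Qed.

Fact tens_eq_opp s t : tens_eq s t ->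
  tens_eq [seq (- p.1, p.2) | p <- s] [seq (- p.1, p.2) | p <- t].
Proof.
elim=> {s t} /=.
- by move=> s; apply: tens_eq_refl.
- by move=> s t _; apply: tens_eq_sym.
- by move=> s t u _ e1 _; apply: tens_eq_trans.
- by move=> s s' t t' _ e1 _ e2; rewrite !map_cat; apply: tens_eq_cat.
- by move=> s t; rewrite !map_cat; apply: tens_eq_catC.
- by move=> x x' y; rewrite opprD; apply: tens_eqDl.
- by move=> x y y'; apply: tens_eqDr.
- by move=> k x y; rewrite -scalerN; apply: tens_eqZ.
- by rewrite oppr0; apply: tens_eq0.
Qed.

Fact tens_pi_opp s :
  tens_opp (\pi_tensor s) = \pi_tensor [seq (- p.1, p.2) | p <- s].
Proof. exact/tens_piP/tens_eq_opp/tens_eq_repr. Qed.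

Fact tens_eq0l y : tens_eq [:: (0, y)] [::].
Proof.
apply: tens_eq_trans tens_eq0.
by have := tens_eqZ 0 0 y; rewrite !scale0r.
Qed.

Fact tens_addA : associative tens_add.
Proof.
move=> u v w; rewrite -[u]reprK -[v]reprK -[w]reprK.
move: (repr u) (repr v) (repr w) => s t r.
by rewrite (tens_pi_add t r) (tens_pi_add s t) !tens_pi_add catA.
Qed.
Fact tens_addC : commutative tens_add.
Proof. by move=> u v; apply/tens_piP; apply: tens_eq_catC. Qed.
Fact tens_add0 : left_id (\pi_tensor [::]) tens_add.
Proof. by move=> u; rewrite -[u]reprK tens_pi_add. Qed.
Fact tens_addN : left_inverse (\pi_tensor [::]) tens_opp tens_add.
Proof.
move=> u; rewrite -[u]reprK tens_pi_opp tens_pi_add; apply/tens_piP.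
elim: (repr u) => [|[x y] s IHs] /=; first exact: tens_eq_refl.
set s' := map _ _ in IHs *.
apply: (@tens_eq_trans _ ((s' ++ s) ++ [:: (- x, y); (x, y)])).
  rewrite -[_ :: _ ++ _]/([:: (- x, y)] ++ (s' ++ ([:: (x, y)] ++ s))).
  apply: tens_eq_trans (tens_eq_catC _ _) _.
  rewrite -!catA; apply: tens_eq_cat; first exact: tens_eq_refl.
  rewrite catA -[[:: _; _]]/([:: (- x, y)] ++ [:: (x, y)]).
  apply: (@tens_eq_trans _ ((s ++ [:: (x, y)]) ++ [:: (- x, y)])).
    by apply: tens_eq_cat; [apply: tens_eq_catC | apply: tens_eq_refl].
  rewrite -catA; apply: tens_eq_cat; first exact: tens_eq_refl.
  exact: tens_eq_catC.
rewrite -[[::]]/([::] ++ [::]); apply: tens_eq_cat => //.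
apply: tens_eq_trans (tens_eq_sym (tens_eqDl _ _ _)) _.
by rewrite addNr; apply: tens_eq0l.
Qed.

HB.instance Definition _ := GRing.isZmodule.Build tensor
  tens_addA tens_addC tens_add0 tens_addN.

Definition tens (x : V) (y : W) : tensor := \pi_tensor [:: (x, y)].

Lemma tensDl x x' y : tens (x + x') y = tens x y + tens x' y.
Proof.
by rewrite [RHS]tens_pi_add; apply/tens_piP/tens_eqDl.
Qed.
Lemma tensDr x y y' : tens x (y + y') = tens x y + tens x y'.
Proof.
by rewrite [RHS]tens_pi_add; apply/tens_piP/tens_eqDr.
Qed.
Lemma tensZlr (k : K) x y : tens (k *: x) y = tens x (k *: y).
Proof. exact/tens_piP/tens_eqZ. Qed.
Lemma tens0l y : tens 0 y = 0.
Proof. by apply: (addrI (tens 0 y)); rewrite -tensDl !addr0. Qed.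
Lemma tens0r x : tens x 0 = 0.
Proof. by apply: (addrI (tens x 0)); rewrite -tensDr !addr0. Qed.
Lemma tensNl x y : tens (- x) y = - tens x y.
Proof. by apply/eqP; rewrite -addr_eq0 -tensDl addNr tens0l. Qed.
Lemma tensNr x y : tens x (- y) = - tens x y.
Proof. by apply/eqP; rewrite -addr_eq0 -tensDr addNr tens0r. Qed.

Lemma tens_pi s : \pi_tensor s = \sum_(p <- s) tens p.1 p.2.
Proof.
elim: s => [|[x y] s IHs]; first by rewrite big_nil.
by rewrite big_cons -IHs /= [RHS]tens_pi_add.
Qed.

Lemma tens_ind (P : tensor -> Prop) :
    P 0 -> (forall x y, P (tens x y)) ->
    (forall u v, P u -> P v -> P (u + v)) -> forall u, P u.
Proof.
move=> P0 P1 PD u; rewrite -[u]reprK tens_pi.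
by elim/big_ind: _ => // -[x y].
Qed.

(* The map u |-> \sum_i f x_i y_i for u = \sum_i x_i (x) y_i; it is meaningful
   when f is K-balanced and biadditive. *)
Definition tens_lift (Z : zmodType) (f : V -> W -> Z) (u : tensor) : Z :=
  \sum_(p <- repr u) f p.1 p.2.

Section Lift.
Variables (Z : zmodType) (f : V -> W -> Z).
Hypothesis fDl : forall x x' y, f (x + x') y = f x y + f x' y.
Hypothesis fDr : forall x y y', f x (y + y') = f x y + f x y'.
Hypothesis fZ : forall (k : K) x y, f (k *: x) y = f x (k *: y).

Lemma tens_lift_pi s : tens_lift f (\pi_tensor s) = \sum_(p <- s) f p.1 p.2.
Proof.
rewrite /tens_lift; move: (tens_eq_repr s); move: (repr _) => t.
elim=> {s t} //=.
- by move=> s t u _ -> _ ->.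
- by move=> s s' t t' _ e1 _ e2; rewrite !big_cat /= e1 e2.
- by move=> s t; rewrite !big_cat /= addrC.
- by move=> x x' y; rewrite !big_cons !big_nil /= fDl !addr0.
- by move=> x y y'; rewrite !big_cons !big_nil /= fDr !addr0.
- by move=> k x y; rewrite !big_seq1 /= fZ.
rewrite big_seq1 big_nil /=; apply: (addrI (f 0 0)).
by rewrite -fDl !addr0.
Qed.

Lemma tens_lift_tens x y : tens_lift f (tens x y) = f x y.
Proof. by rewrite tens_lift_pi big_seq1. Qed.

Lemma tens_liftD u v : tens_lift f (u + v) = tens_lift f u + tens_lift f v.
Proof.
by rewrite -[u]reprK -[v]reprK [_ + _]tens_pi_add !tens_lift_pi big_cat.
Qed.

Lemma tens_lift0 : tens_lift f 0 = 0.
Proof. by rewrite -[0 in LHS]/(\pi_tensor [::]) tens_lift_pi big_nil. Qed.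
End Lift.

Definition tens_scale (k : K) (u : tensor) : tensor :=
  tens_lift (fun x y => tens (k *: x) y) u.

Fact tens_scale_tens k x y : tens_scale k (tens x y) = tens (k *: x) y.
Proof.
apply: tens_lift_tens => [x0 x1 y0|x0 y0 y1|l x0 y0].
- by rewrite scalerDr tensDl.
- by rewrite tensDr.
- by rewrite scalerA mulrC -scalerA tensZlr.
Qed.
Fact tens_scaleDr : right_distributive tens_scale +%R.
Proof.
move=> k u v; apply: tens_liftD => [x0 x1 y0|x0 y0 y1|l x0 y0].
- by rewrite scalerDr tensDl.
- by rewrite tensDr.
- by rewrite scalerA mulrC -scalerA tensZlr.
Qed.
Fact tens_scale0 k : tens_scale k 0 = 0.
Proof. by apply: (addrI (tens_scale k 0)); rewrite -tens_scaleDr !addr0. Qed.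
Fact tens_scaleA k l u :
  tens_scale k (tens_scale l u) = tens_scale (k * l) u.
Proof.
elim/tens_ind: u => [|x y|u v IHu IHv]; rewrite ?tens_scale0 //.
- by rewrite !tens_scale_tens scalerA.
- by rewrite !tens_scaleDr IHu IHv.
Qed.
Fact tens_scale1 : left_id 1 tens_scale.
Proof.
elim/tens_ind => [|x y|u v IHu IHv]; rewrite ?tens_scale0 //.
- by rewrite tens_scale_tens scale1r.
- by rewrite tens_scaleDr IHu IHv.
Qed.
Fact tens_scaleDl u : {morph tens_scale^~ u : k l / k + l}.
Proof.
move=> k l; elim/tens_ind: u => [|x y|u v IHu IHv].
- by rewrite /= !tens_scale0 addr0.
- by rewrite /= !tens_scale_tens scalerDl tensDl.
- by rewrite /= !tens_scaleDr IHu IHv addrACA.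
Qed.

HB.instance Definition _ := GRing.Zmodule_isLmodule.Build K tensor
  tens_scaleA tens_scale1 tens_scaleDr tens_scaleDl.

Lemma tensZl (k : K) x y : tens (k *: x) y = k *: tens x y.
Proof. by rewrite -tens_scale_tens. Qed.
Lemma tensZr (k : K) x y : tens x (k *: y) = k *: tens x y.
Proof. by rewrite -tensZlr tensZl. Qed.

(* Universal property. *)
Lemma tensor_universal (U : lmodType K) (f : V -> W -> U) :
    (forall y, linear (f^~ y)) -> (forall x, linear (f x)) ->
  exists! g : tensor -> U, linear g /\ forall x y, g (tens x y) = f x y.
Proof.
move=> fl fr.
have fDl x x' y : f (x + x') y = f x y + f x' y.
  by have := fl y 1 x x'; rewrite !scale1r.
have fDr x y y' : f x (y + y') = f x y + f x y'.
  by have := fr x 1 y y'; rewrite !scale1r.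
have f0l y : f 0 y = 0 by apply: (addrI (f 0 y)); rewrite -fDl !addr0.
have f0r x : f x 0 = 0 by apply: (addrI (f x 0)); rewrite -fDr !addr0.
have fZl (k : K) x y : f (k *: x) y = k *: f x y.
  by have := fl y k x 0; rewrite /= f0l !addr0.
have fZr (k : K) x y : f x (k *: y) = k *: f x y.
  by have := fr x k y 0; rewrite /= f0r !addr0.
have fZ (k : K) x y : f (k *: x) y = f x (k *: y) by rewrite fZl fZr.
have gD := tens_liftD fDl fDr fZ; have g0 := tens_lift0 fDl fDr fZ.
have gE := tens_lift_tens fDl fDr fZ.
exists (tens_lift f); split=> [|h [hl hE]].
  split=> // k u v; rewrite gD; congr (_ + _).
  elim/tens_ind: u => [|x y|u u' IHu IHu']; first by rewrite scaler0 g0 scaler0.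
  - by rewrite -tensZl !gE fZl.
  - by rewrite scalerDr !gD IHu IHu' scalerDr.
have hD u v : h (u + v) = h u + h v by have := hl 1 u v; rewrite !scale1r.
apply: funext => u; elim/tens_ind: u => [|x y|u u' IHu IHu'].
- by rewrite g0; apply: (addrI (h 0)); rewrite -hD !addr0.
- by rewrite gE hE.
- by rewrite gD hD IHu IHu'.
Qed.
End Tensor.

(** Lie algebras and Lie algebra homomorphisms into gl(V) *)

Record lie_bracket (K : comPzRingType) (g : lmodType K) (br : g -> g -> g)
    : Prop := LieBracket {
  lie_linearl : forall y, linear (br^~ y);
  lie_linearr : forall x, linear (br x);
  lie_alt : forall x, br x x = 0;
  lie_jacobi : forall x y z, br x (br y z) + br y (br z x) + br z (br x y) = 0
}.

(* rho is a Lie algebra homomorphism from (g, br) to gl_K(V), the K-linear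
   endomorphisms of V with the commutator bracket. *)
Record gl_hom (K : comPzRingType) (g : lmodType K) (br : g -> g -> g)
    (V : lmodType K) (rho : g -> V -> V) : Prop := GlHom {
  gl_hom_end : forall x, linear (rho x);
  gl_hom_linear : forall (k : K) x y v,
    rho (k *: x + y) v = k *: rho x v + rho y v;
  gl_hom_bracket : forall x y v,
    rho (br x y) v = rho x (rho y v) - rho y (rho x v)
}.

Record derivation (K : comPzRingType) (A : comAlg K) (d : A -> A)
    : Prop := Derivation {
  der_linear : linear (d : alg_mod A -> alg_mod A);
  der_mul : forall a b, d (a * b) = a * d b + d a * b
}.

(* Since Der_K(A) is a Lie subalgebra of gl_K(A), Lie algebra homomorphisms
   into Der_K(A) are those into gl_K(A) with values in derivations. *)
Record der_hom (K : comPzRingType) (A : comAlg K) (g : lmodType K)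
    (br : g -> g -> g) (beta : g -> A -> A) : Prop := DerHom {
  der_hom_gl : gl_hom br (beta : g -> alg_mod A -> alg_mod A);
  der_hom_der : forall x, derivation (beta x)
}.

Record leibnizPair (K : comPzRingType) (A : comAlg K) := LeibnizPair {
  lp_mod :> lmodType K;
  lp_bracket : lp_mod -> lp_mod -> lp_mod;
  lp_anchor : lp_mod -> A -> A;
  lp_lie : lie_bracket lp_bracket;
  lp_der : der_hom lp_bracket lp_anchor
}.

Record lieRinehart (K : comPzRingType) (A : comAlg K) := LieRinehart {
  lr_mod :> lmodType A;
  lr_bracket : restr lr_mod -> restr lr_mod -> restr lr_mod;
  lr_anchor : lr_mod -> A -> A;
  lr_lie : lie_bracket lr_bracket;
  lr_der : der_hom lr_bracket (lr_anchor : restr lr_mod -> A -> A);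
  lr_anchor_linear : forall (a : A) (x y : lr_mod) b,
    lr_anchor (a *: x + y) b = a * lr_anchor x b + lr_anchor y b;
  lr_leibniz : forall (x y : lr_mod) (a : A),
    lr_bracket x (a *: y) = a *: (lr_bracket x y : lr_mod) + lr_anchor x a *: y
}.

(** The action Lie-Rinehart algebra of a Leibniz pair *)

(* S (x) A with A acting on the second factor. *)
Definition act_mod (K : comPzRingType) (A : comAlg K) (S : leibnizPair A)
  : Type := tensor S (alg_mod A).

Section ActionModule.
Variables (K : comPzRingType) (A : comAlg K) (S : leibnizPair A).
Local Notation T := (act_mod S).

HB.instance Definition _ := GRing.Zmodule.on T.

(* The pure tensor x (x) a. *)
Definition act_tens (x : S) (a : A) : T := @tens K S (alg_mod A) x a.

Lemma act_tensDl x y a : act_tens (x + y) a = act_tens x a + act_tens y a.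
Proof. exact: tensDl. Qed.
Lemma act_tensDr x a b : act_tens x (a + b) = act_tens x a + act_tens x b.
Proof. exact: (@tensDr K S (alg_mod A)). Qed.
Lemma act_tensNl x a : act_tens (- x) a = - act_tens x a.
Proof. exact: tensNl. Qed.
Lemma act_tensNr x a : act_tens x (- a) = - act_tens x a.
Proof. exact: (@tensNr K S (alg_mod A)). Qed.
Lemma act_tens0l a : act_tens 0 a = 0.
Proof. exact: tens0l. Qed.
Lemma act_tens0r x : act_tens x 0 = 0.
Proof. exact: (@tens0r K S (alg_mod A)). Qed.
Lemma act_tensZ (k : K) x a :
  act_tens (k *: x) a = act_tens x (alg_map A k * a).
Proof. exact: (@tensZlr K S (alg_mod A)). Qed.

Lemma act_ind (P : T -> Prop) :
    P 0 -> (forall x a, P (act_tens x a)) ->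
    (forall u v, P u -> P v -> P (u + v)) -> forall u, P u.
Proof. exact: (@tens_ind K S (alg_mod A)). Qed.

Section Lift.
Variables (Z : zmodType) (f : S -> A -> Z).

Definition act_lift (u : T) : Z := @tens_lift K S (alg_mod A) Z f u.

Hypothesis fDl : forall x y a, f (x + y) a = f x a + f y a.
Hypothesis fDr : forall x a b, f x (a + b) = f x a + f x b.
Hypothesis fZ : forall (k : K) x a, f (k *: x) a = f x (alg_map A k * a).

Lemma act_lift_tens x a : act_lift (act_tens x a) = f x a.
Proof. exact: (@tens_lift_tens K S (alg_mod A)). Qed.
Lemma act_liftD u v : act_lift (u + v) = act_lift u + act_lift v.
Proof. exact: (@tens_liftD K S (alg_mod A)). Qed.
End Lift.

Lemma eq_act_lift (Z : zmodType) (f g : S -> A -> Z) u :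
  (forall x a, f x a = g x a) -> act_lift f u = act_lift g u.
Proof. by move=> e; apply: eq_bigr. Qed.
Lemma act_lift_add (Z : zmodType) (f g : S -> A -> Z) u :
  act_lift (fun x a => f x a + g x a) u = act_lift f u + act_lift g u.
Proof. exact: big_split. Qed.

Definition act_scale (a : A) : T -> T := act_lift (fun x b => act_tens x (a * b)).

Fact act_scale_tens a x b : act_scale a (act_tens x b) = act_tens x (a * b).
Proof.
apply: act_lift_tens => [x0 x1 y0|x0 y0 y1|l x0 y0].
- by rewrite act_tensDl.
- by rewrite mulrDr act_tensDr.
- by rewrite act_tensZ mulrCA.
Qed.
Fact act_scaleDr : right_distributive act_scale +%R.
Proof.
move=> a u v; apply: act_liftD => [x0 x1 y0|x0 y0 y1|l x0 y0].
- by rewrite act_tensDl.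
- by rewrite mulrDr act_tensDr.
- by rewrite act_tensZ mulrCA.
Qed.
Fact act_scale0 a : act_scale a 0 = 0.
Proof. by apply: (addrI (act_scale a 0)); rewrite -act_scaleDr !addr0. Qed.
Fact act_scaleA a b u :
  act_scale a (act_scale b u) = act_scale (a * b) u.
Proof.
elim/act_ind: u => [|x c|u v IHu IHv]; rewrite ?act_scale0 //.
- by rewrite !act_scale_tens mulrA.
- by rewrite !act_scaleDr IHu IHv.
Qed.
Fact act_scale1 : left_id 1 act_scale.
Proof.
elim/act_ind => [|x a|u v IHu IHv]; rewrite ?act_scale0 //.
- by rewrite act_scale_tens mul1r.
- by rewrite act_scaleDr IHu IHv.
Qed.
Fact act_scaleDl u : {morph act_scale^~ u : a b / a + b}.
Proof.
move=> a b; elim/act_ind: u => [|x c|u v IHu IHv].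
- by rewrite /= !act_scale0 addr0.
- by rewrite /= !act_scale_tens mulrDl act_tensDr.
- by rewrite /= !act_scaleDr IHu IHv addrACA.
Qed.

HB.instance Definition _ := GRing.Zmodule_isLmodule.Build A T
  act_scaleA act_scale1 act_scaleDr act_scaleDl.

Lemma act_tensZr (a : A) x b : a *: act_tens x b = act_tens x (a * b).
Proof. exact: act_scale_tens. Qed.

(* The K-structure restricted from A is that of the tensor product over K. *)
Lemma act_restrE (k : K) (u : tensor S (alg_mod A)) :
  k *: (u : restr T) = k *: u :> tensor S (alg_mod A).
Proof.
rewrite [LHS]/(act_scale (alg_map A k) (u : T)).
elim/tens_ind: u => [|x a|u v IHu IHv].
- by rewrite scaler0; apply: act_scale0.
- by rewrite -tensZr; apply: act_scale_tens.
- by rewrite scalerDr -IHu -IHv; apply: act_scaleDr.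
Qed.
End ActionModule.

Lemma linear_fD (K : comPzRingType) (U V : lmodType K) (f : U -> V) :
  linear f -> forall x y, f (x + y) = f x + f y.
Proof. by move=> fl x y; have := fl 1 x y; rewrite !scale1r. Qed.
Lemma linear_f0 (K : comPzRingType) (U V : lmodType K) (f : U -> V) :
  linear f -> f 0 = 0.
Proof.
by move=> fl; apply: (addrI (f 0)); rewrite -(linear_fD fl) !addr0.
Qed.
Lemma linear_fZ (K : comPzRingType) (U V : lmodType K) (f : U -> V) :
  linear f -> forall (k : K) x, f (k *: x) = k *: f x.
Proof. by move=> fl k x; have := fl k x 0; rewrite (linear_f0 fl) !addr0. Qed.

Section ActionLieRinehart.
Variables (K : comPzRingType) (A : comAlg K) (S : leibnizPair A).
Local Notation T := (act_mod S).
Local Notation br := (@lp_bracket K A S).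
Local Notation beta := (@lp_anchor K A S).
Local Notation "x \ox a" := (@act_tens K A S x a) (at level 40).

Definition act_bracket (u v : T) : T :=
  act_lift (fun x a => act_lift (fun y b =>
    br x y \ox (a * b) + y \ox (a * beta x b) - x \ox (b * beta y a)) v) u.

Definition act_anchor (u : T) (b : A) : A := act_lift (fun x a => a * beta x b) u.

Let betaE := der_hom_gl (lp_der S).
Let betaL x : linear (beta x : alg_mod A -> alg_mod A) := gl_hom_end betaE x.
Let betaD x a b : beta x (a + b) = beta x a + beta x b.
Proof. exact: (linear_fD (betaL x)). Qed.
Let beta0 x : beta x 0 = 0.
Proof. exact: (linear_f0 (betaL x)). Qed.
Let betaN x a : beta x (- a) = - beta x a.
Proof. by apply/eqP; rewrite -addr_eq0 -betaD addNr beta0. Qed.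
Let betaZ x (k : K) a : beta x (alg_map A k * a) = alg_map A k * beta x a.
Proof. exact: (linear_fZ (betaL x)). Qed.
Let betaM x a b : beta x (a * b) = a * beta x b + beta x a * b.
Proof. exact: (der_mul (der_hom_der (lp_der S) x)). Qed.
Let beta_const x (k : K) : beta x (alg_map A k) = 0.
Proof.
rewrite -[alg_map A k]mulr1 betaZ.
suff -> : beta x 1 = 0 by rewrite mulr0.
apply: (addrI (beta x 1)); rewrite addr0.
by have := betaM x 1 1; rewrite !mulr1 mul1r.
Qed.
Let betaDl x y a : beta (x + y) a = beta x a + beta y a.
Proof. by have := gl_hom_linear betaE 1 x y a; rewrite !scale1r. Qed.
Let beta0l a : beta 0 a = 0.
Proof. by apply: (addrI (beta 0 a)); rewrite -betaDl !addr0. Qed.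
Let betaZl (k : K) x a : beta (k *: x) a = alg_map A k * beta x a.
Proof.
by have := gl_hom_linear betaE k x 0 a; rewrite beta0l !addr0 => ->.
Qed.
Let betaB x y a : beta (br x y) a = beta x (beta y a) - beta y (beta x a).
Proof. exact: (gl_hom_bracket betaE). Qed.

Let brDl x y z : br (x + y) z = br x z + br y z.
Proof. exact: (linear_fD (lie_linearl (lp_lie S) z)). Qed.
Let brDr x y z : br x (y + z) = br x y + br x z.
Proof. exact: (linear_fD (lie_linearr (lp_lie S) x)). Qed.
Let brZl (k : K) x y : br (k *: x) y = k *: br x y.
Proof. exact: (linear_fZ (lie_linearl (lp_lie S) y)). Qed.
Let brZr (k : K) x y : br x (k *: y) = k *: br x y.
Proof. exact: (linear_fZ (lie_linearr (lp_lie S) x)). Qed.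
Let brxx x : br x x = 0.
Proof. exact: (lie_alt (lp_lie S)). Qed.
Let brC x y : br x y = - br y x.
Proof.
apply/eqP; rewrite -addr_eq0; apply/eqP.
by have := brxx (x + y); rewrite brDl !brDr !brxx add0r addr0.
Qed.

Let g x a y b :=
  br x y \ox (a * b) + y \ox (a * beta x b) - x \ox (b * beta y a).

Let gDl x x' a y b : g (x + x') a y b = g x a y b + g x' a y b.
Proof.
rewrite /g brDl betaDl mulrDr !act_tensDl !act_tensDr opprD.
by rewrite [LHS](AC (2*2*2) ((1*3*5)*(2*4*6))).
Qed.
Let gDal x a a' y b : g x (a + a') y b = g x a y b + g x a' y b.
Proof.
rewrite /g !mulrDl betaD mulrDr !act_tensDr opprD.
by rewrite [LHS](AC (2*2*2) ((1*3*5)*(2*4*6))).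
Qed.
Let gZl (k : K) x a y b : g (k *: x) a y b = g x (alg_map A k * a) y b.
Proof.
rewrite /g brZl betaZl !act_tensZ betaZ.
by congr (_ + _ - _); congr act_tens; ring.
Qed.
Let gDr x a y y' b : g x a (y + y') b = g x a y b + g x a y' b.
Proof.
rewrite /g brDr betaDl mulrDr !act_tensDl !act_tensDr opprD.
by rewrite [LHS](AC (2*2*2) ((1*3*5)*(2*4*6))).
Qed.
Let gDbr x a y b b' : g x a y (b + b') = g x a y b + g x a y b'.
Proof.
rewrite /g mulrDl betaD !mulrDr !act_tensDr opprD.
by rewrite [LHS](AC (2*2*2) ((1*3*5)*(2*4*6))).
Qed.
Let gZr (k : K) x a y b : g x a (k *: y) b = g x a y (alg_map A k * b).
Proof.
rewrite /g brZr betaZl !act_tensZ betaZ.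
by congr (_ + _ - _); congr act_tens; ring.
Qed.

Let h v x a := act_lift (g x a) v.
Let hDl v x x' a : h v (x + x') a = h v x a + h v x' a.
Proof. by rewrite -act_lift_add; apply: eq_act_lift => y b; apply: gDl. Qed.
Let hDr v x a a' : h v x (a + a') = h v x a + h v x a'.
Proof. by rewrite -act_lift_add; apply: eq_act_lift => y b; apply: gDal. Qed.
Let hZ v (k : K) x a : h v (k *: x) a = h v x (alg_map A k * a).
Proof. by apply: eq_act_lift => y b; apply: gZl. Qed.

Lemma act_bracketE x a y b :
  act_bracket (x \ox a) (y \ox b) =
  br x y \ox (a * b) + y \ox (a * beta x b) - x \ox (b * beta y a).
Proof.
rewrite [LHS](act_lift_tens (hDl _) (hDr _) (hZ _)).
exact: (act_lift_tens (gDr _ _) (gDbr _ _) (fun k => gZr k _ _)).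
Qed.

Let brTDl u v w : act_bracket (u + v) w = act_bracket u w + act_bracket v w.
Proof. exact: (act_liftD (hDl _) (hDr _) (hZ _)). Qed.
Let brTDr u v w : act_bracket u (v + w) = act_bracket u v + act_bracket u w.
Proof.
rewrite -act_lift_add; apply: eq_act_lift => x a.
exact: (act_liftD (gDr _ _) (gDbr _ _) (fun k => gZr k _ _)).
Qed.
Let brT0l u : act_bracket 0 u = 0.
Proof. by apply: (addrI (act_bracket 0 u)); rewrite -brTDl !addr0. Qed.
Let brT0r u : act_bracket u 0 = 0.
Proof. by apply: (addrI (act_bracket u 0)); rewrite -brTDr !addr0. Qed.
Let brTNr u v : act_bracket u (- v) = - act_bracket u v.
Proof. by apply/eqP; rewrite -addr_eq0 -brTDr addNr brT0r. Qed.

Let ancDl b x y a : a * beta (x + y) b = a * beta x b + a * beta y b.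
Proof. by rewrite betaDl mulrDr. Qed.
Let ancDr b (x : S) a a' : (a + a') * beta x b = a * beta x b + a' * beta x b.
Proof. exact: mulrDl. Qed.
Let ancZ b (k : K) x a : a * beta (k *: x) b = alg_map A k * a * beta x b.
Proof. by rewrite betaZl mulrCA mulrA. Qed.

Lemma act_anchorE x a b : act_anchor (x \ox a) b = a * beta x b.
Proof. exact: (act_lift_tens (ancDl b) (ancDr b) (ancZ b)). Qed.

Let ancD u v b : act_anchor (u + v) b = act_anchor u b + act_anchor v b.
Proof. exact: (act_liftD (ancDl b) (ancDr b) (ancZ b)). Qed.
Let anc0 b : act_anchor 0 b = 0.
Proof. by apply: (addrI (act_anchor 0 b)); rewrite -ancD !addr0. Qed.
Let ancN u b : act_anchor (- u) b = - act_anchor u b.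
Proof. by apply/eqP; rewrite -addr_eq0 -ancD addNr anc0. Qed.
Let ancZl (a : A) u b : act_anchor (a *: u) b = a * act_anchor u b.
Proof.
elim/act_ind: u => [|x c|u v IHu IHv]; first by rewrite scaler0 anc0 mulr0.
- by rewrite act_tensZr !act_anchorE mulrA.
- by rewrite scalerDr !ancD IHu IHv mulrDr.
Qed.
Let ancDa u a b : act_anchor u (a + b) = act_anchor u a + act_anchor u b.
Proof.
elim/act_ind: u => [|x c|u v IHu IHv]; first by rewrite !anc0 addr0.
- by rewrite !act_anchorE betaD mulrDr.
- by rewrite !ancD IHu IHv addrACA.
Qed.
Let ancMa u a b :
  act_anchor u (a * b) = a * act_anchor u b + act_anchor u a * b.
Proof.
elim/act_ind: u => [|x c|u v IHu IHv].
- by rewrite !anc0 mulr0 mul0r addr0.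
- by rewrite !act_anchorE betaM; ring.
- by rewrite !ancD IHu IHv; ring.
Qed.
Let anc_const u (k : K) : act_anchor u (alg_map A k) = 0.
Proof.
elim/act_ind: u => [|x c|u v IHu IHv]; first exact: anc0.
- by rewrite act_anchorE beta_const mulr0.
- by rewrite ancD IHu IHv addr0.
Qed.

Fact act_leibniz (u v : T) (a : A) :
  act_bracket u (a *: v) = a *: act_bracket u v + act_anchor u a *: v.
Proof.
elim/act_ind: u => [|x b|u u' IHu IHu'].
- by rewrite !brT0l anc0 scaler0 scale0r addr0.
- elim/act_ind: v => [|y c|v v' IHv IHv'].
  + by rewrite !(scaler0, brT0r) addr0.
  + rewrite act_tensZr !act_bracketE act_anchorE scalerDr scalerDr scalerN.
    rewrite !act_tensZr betaM mulrDr act_tensDr.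
    rewrite [RHS](ACl (1*(2*4)*3)) /=.
    by congr (_ + (_ + _) - _); congr act_tens; ring.
  + by rewrite !(scalerDr, brTDr) IHv IHv' addrACA.
- by rewrite !(brTDl, ancD, scalerDr, scalerDl) IHu IHu' addrACA.
Qed.

Let brTxx u : act_bracket u u = 0.
Proof.
have brTC0 x a y b : act_bracket (x \ox a) (y \ox b) = 
    - act_bracket (y \ox b) (x \ox a).
  rewrite !act_bracketE brC act_tensNl !opprD opprK (mulrC b a).
  by rewrite [RHS](ACl (1*3*2)).
have brTC v w : act_bracket v w = - act_bracket w v.
  elim/act_ind: v => [|x a|v v' IHv IHv'].
  - by rewrite brT0l brT0r oppr0.
  - elim/act_ind: w => [|y b|w w' IHw IHw']; last 1 first.
    + by rewrite brTDl brTDr IHw IHw' opprD.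
    + by rewrite brT0l brT0r oppr0.
    + exact: brTC0.
  - by rewrite brTDl brTDr IHv IHv' opprD.
elim/act_ind: u => [|x a|u v IHu IHv]; first exact: brT0l.
- by rewrite act_bracketE brxx act_tens0l add0r subrr.
- by rewrite brTDl !brTDr IHu IHv add0r addr0 (brTC v u) subrr.
Qed.

Let double_bracketE x a y b z c :
  act_bracket (x \ox a) (act_bracket (y \ox b) (z \ox c)) =
    br x (br y z) \ox (a * (b * c)) + br y z \ox (a * beta x (b * c))
    + br z x \ox (- (a * (b * beta y c))) + br x y \ox (- (a * (c * beta z b)))
    + x \ox (- (b * c * beta (br y z) a) - b * beta y c * beta z a
             + c * beta z b * beta y a)
    + y \ox (- (a * beta x (c * beta z b))) + z \ox (a * beta x (b * beta y c)).
Proof.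
rewrite (act_bracketE y) !brTDr brTNr !act_bracketE.
rewrite (brC x z) !(act_tensDr, act_tensNr, act_tensNl, opprD, opprK).
by rewrite [LHS](AC (3*3*3) (1*2*4*7*(3*6*9)*8*5)).
Qed.

Let sum7 (Z : zmodType) (a1 a2 a3 a4 a5 a6 a7 b1 b2 b3 b4 b5 b6 b7
    c1 c2 c3 c4 c5 c6 c7 : Z) :
  a1 + a2 + a3 + a4 + a5 + a6 + a7 + (b1 + b2 + b3 + b4 + b5 + b6 + b7)
    + (c1 + c2 + c3 + c4 + c5 + c6 + c7) =
  (a1 + b1 + c1) + (a2 + b2 + c2) + (a3 + b3 + c3) + (a4 + b4 + c4)
    + (a5 + b5 + c5) + (a6 + b6 + c6) + (a7 + b7 + c7).
Proof.
by rewrite [LHS](AC (7*7*7) ((1*8*15)*(2*9*16)*(3*10*17)*(4*11*18)*(5*12*19)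
  *(6*13*20)*(7*14*21))).
Qed.

Let brTJ u v w : act_bracket u (act_bracket v w)
  + act_bracket v (act_bracket w u) + act_bracket w (act_bracket u v) = 0.
Proof.
elim/act_ind: u => [|x a|u u' IHu IHu'].
- by rewrite !(brT0l, brT0r) !addr0.
- elim/act_ind: v => [|y b|v v' IHv IHv'].
  + by rewrite !(brT0l, brT0r) !addr0.
  + elim/act_ind: w => [|z c|w w' IHw IHw'].
    * by rewrite !(brT0l, brT0r) !addr0.
    * rewrite (double_bracketE x) (double_bracketE y) (double_bracketE z).
      rewrite [X in _ + X + _](ACl (1*4*2*3*7*5*6)).
      rewrite [X in _ + _ + X](ACl (1*3*4*2*6*7*5)) sum7.
      rewrite -!act_tensDr.
      rewrite (_ : b * (c * a) = a * (b * c)); last by ring.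
      rewrite (_ : c * (a * b) = a * (b * c)); last by ring.
      rewrite -!act_tensDl (lie_jacobi (lp_lie S)) act_tens0l add0r.
      rewrite !betaM !betaB.
      have E t d : d = 0 -> t \ox d = 0 by move=> ->; apply: act_tens0r.
      by rewrite !E ?addr0 //; ring.
    * by rewrite !(brTDl, brTDr) [LHS](AC (2*2*2) ((1*3*5)*(2*4*6))) /=
        IHw IHw' addr0.
  + by rewrite !(brTDl, brTDr) [LHS](AC (2*2*2) ((1*3*5)*(2*4*6))) /=
      IHv IHv' addr0.
- by rewrite !(brTDl, brTDr) [LHS](AC (2*2*2) ((1*3*5)*(2*4*6))) /=
    IHu IHu' addr0.
Qed.

Fact act_der : der_hom (act_bracket : restr T -> restr T -> restr T)
  (act_anchor : restr T -> A -> A).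
Proof.
have ancB u v b : act_anchor (act_bracket u v) b =
    act_anchor u (act_anchor v b) - act_anchor v (act_anchor u b).
  elim/act_ind: u => [|x a|u u' IHu IHu'].
  - rewrite brT0l !anc0 sub0r; apply/esym/eqP.
    rewrite oppr_eq0; apply/eqP; apply: (addrI (act_anchor v 0)).
    by rewrite -ancDa !addr0.
  - elim/act_ind: v => [|y c|v v' IHv IHv'].
    + by rewrite brT0r !anc0 act_anchorE beta0 mulr0 subr0.
    + rewrite act_bracketE !(ancD, ancN, act_anchorE) !betaM betaB; ring.
    + by rewrite brTDr !ancD ancDa IHv IHv'; ring.
  - by rewrite brTDl !ancD ancDa IHu IHu'; ring.
split=> [|u]; last first.
  split=> [k a b|a b]; last exact: ancMa.
  by rewrite ancDa ancMa anc_const mul0r addr0.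
split=> [u k a b|k u v b|u v b].
- by rewrite ancDa ancMa anc_const mul0r addr0.
- by rewrite ancD ancZl.
- exact: ancB.
Qed.

Fact act_lie : lie_bracket (act_bracket : restr T -> restr T -> restr T).
Proof.
have lr (u : T) : linear (act_bracket u : restr T -> restr T).
  move=> k v w; rewrite brTDr; congr (_ + _).
  by rewrite act_leibniz anc_const scale0r addr0.
have brTC u v : act_bracket u v = - act_bracket v u.
  apply/eqP; rewrite -addr_eq0; apply/eqP.
  by have := brTxx (u + v); rewrite brTDl !brTDr !brTxx add0r addr0.
split=> [v k u w|u|u|u v w].
- rewrite brTC [in RHS]brTC [act_bracket w v]brTC lr opprD.
  by congr (_ + _); rewrite [RHS]scalerN.
- exact: lr.
- exact: brTxx.
- exact: brTJ.
Qed.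

Fact act_anchor_linear (a : A) (u v : T) b :
  act_anchor (a *: u + v) b = a * act_anchor u b + act_anchor v b.
Proof. by rewrite ancD ancZl. Qed.

Definition actionLR : lieRinehart A := @LieRinehart K A T
  act_bracket act_anchor act_lie act_der act_anchor_linear act_leibniz.
End ActionLieRinehart.

(** Categories *)

Record category := Category {
  obj :> Type;
  mor : obj -> obj -> Type;
  idc : forall X, mor X X;
  comp : forall X Y Z, mor Y Z -> mor X Y -> mor X Z;
  comp_idl : forall X Y (f : mor X Y), comp (idc Y) f = f;
  comp_idr : forall X Y (f : mor X Y), comp f (idc X) = f;
  comp_assoc : forall X Y Z T (f : mor Z T) (g : mor Y Z) (h : mor X Y),
    comp f (comp g h) = comp (comp f g) h
}.
Arguments idc {c} X.
Arguments comp {c X Y Z} f g.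

Record functor (C D : category) := Functor {
  fobj :> C -> D;
  fmor : forall X Y, mor X Y -> mor (fobj X) (fobj Y);
  fmor_id : forall X, fmor (idc X) = idc (fobj X);
  fmor_comp : forall X Y Z (f : mor Y Z) (g : mor X Y),
    fmor (comp f g) = comp (fmor f) (fmor g)
}.
Arguments fmor {C D} F {X Y} f : rename.

Section Functors.
Variables C D E : category.

Definition functor_id : functor C C :=
  @Functor C C id (fun _ _ f => f) (fun _ => erefl) (fun _ _ _ _ _ => erefl).

Fact functor_comp_id (G : functor D E) (F : functor C D) X :
  fmor G (fmor F (idc X)) = idc (G (F X)).
Proof. by rewrite !fmor_id. Qed.
Fact functor_comp_comp (G : functor D E) (F : functor C D) X Y Z
    (f : mor Y Z) (g : mor X Y) :
  fmor G (fmor F (comp f g)) = comp (fmor G (fmor F f)) (fmor G (fmor F g)).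
Proof. by rewrite !fmor_comp. Qed.

Definition functor_comp (G : functor D E) (F : functor C D) : functor C E :=
  @Functor C E (fun X => G (F X)) (fun _ _ f => fmor G (fmor F f))
    (functor_comp_id G F) (functor_comp_comp G F).

Definition is_iso (X Y : C) (f : mor X Y) : Prop :=
  exists g : mor Y X, comp g f = idc X /\ comp f g = idc Y.
End Functors.

Definition naturally_isomorphic (C D : category) (F G : functor C D) : Prop :=
  exists eta : forall X, mor (F X) (G X),
    (forall X Y (f : mor X Y), comp (eta Y) (fmor F f) = comp (fmor G f) (eta X))
    /\ (forall X, is_iso (eta X)).

Definition equivalence (C D : category) (F : functor C D) (G : functor D C)
    : Prop :=
  naturally_isomorphic (functor_comp G F) (functor_id C) /\
  naturally_isomorphic (functor_comp F G) (functor_id D).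

(** Categories of representations *)

Record admissible (K : comPzRingType) (A : comAlg K) (S : leibnizPair A)
    (M : lmodType A) (rho : S -> M -> M) : Prop := Admissible {
  adm_gl : gl_hom (@lp_bracket K A S) (rho : S -> restr M -> restr M);
  adm_leibniz : forall (x : S) (a : A) (m : M),
    rho x (a *: m) = a *: rho x m + lp_anchor x a *: m
}.

Record lr_representation (K : comPzRingType) (A : comAlg K)
    (L : lieRinehart A) (M : lmodType A) (rho : L -> M -> M) : Prop :=
    LrRepresentation {
  lrr_gl : gl_hom (@lr_bracket K A L) (rho : restr L -> restr M -> restr M);
  lrr_linear : forall (a : A) (x y : L) (m : M),
    rho (a *: x + y) m = a *: rho x m + rho y m;
  lrr_leibniz : forall (x : L) (a : A) (m : M),
    rho x (a *: m) = a *: rho x m + lr_anchor x a *: m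
}.

(* Both categories of representations have the same form: an object is an
   A-module M with an action X -> M -> M subject to some axioms [ax], and a
   morphism is an A-linear map commuting with the actions. *)
Section Representations.
Variables (A : comPzRingType) (X : Type).
Variable ax : forall M : lmodType A, (X -> M -> M) -> Prop.

Record rep := Rep {
  rep_mod :> lmodType A;
  rep_act : X -> rep_mod -> rep_mod;
  rep_ax : ax rep_act
}.

Record rep_hom (M N : rep) := RepHom {
  rep_fun :> M -> N;
  rep_linear : linear rep_fun;
  rep_comm : forall x m, rep_fun (rep_act x m) = rep_act x (rep_fun m)
}.

Lemma rep_homP (M N : rep) (f g : rep_hom M N) : f =1 g -> f = g.
Proof.
case: f g => [f fl fc] [g gl gc] /= /funext e.
by case: _ / e in gl gc *; congr RepHom; apply: Prop_irrelevance.
Qed.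

Definition rep_id (M : rep) : rep_hom M M :=
  @RepHom M M id (fun _ _ _ => erefl) (fun _ _ => erefl).

Fact rep_comp_linear (M N P : rep) (f : rep_hom N P) (g : rep_hom M N) :
  linear (f \o g).
Proof. by move=> a u v; rewrite /= !rep_linear. Qed.
Fact rep_comp_comm (M N P : rep) (f : rep_hom N P) (g : rep_hom M N) x m :
  (f \o g) (rep_act x m) = rep_act x ((f \o g) m).
Proof. by rewrite /= !rep_comm. Qed.

Definition rep_comp (M N P : rep) (f : rep_hom N P) (g : rep_hom M N) :
  rep_hom M P := RepHom (rep_comp_linear f g) (rep_comp_comm f g).

Definition rep_cat : category.
Proof.
apply: (@Category rep rep_hom rep_id rep_comp) => *; exact: rep_homP.
Defined.
End Representations.

(* The functor (M; rho) |-> (M; F (M; rho)) and phi |-> phi, for an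
   assignment F of actions on the same underlying modules. *)
Section ChangeOfAction.
Variables (A : comPzRingType) (X Y : Type).
Variable axX : forall M : lmodType A, (X -> M -> M) -> Prop.
Variable axY : forall M : lmodType A, (Y -> M -> M) -> Prop.
Variable F : forall M : rep axX, Y -> M -> M.
Hypothesis F_ax : forall M, axY (F (M := M)).
Hypothesis F_comm : forall (M N : rep axX) (phi : rep_hom M N) y m,
  phi (F y m) = F y (phi m).

Definition change_obj (M : rep axX) : rep axY := Rep (@F_ax M).

Definition change_mor (M N : rep axX) (phi : rep_hom M N) :
  rep_hom (change_obj M) (change_obj N) :=
  @RepHom A Y axY (change_obj M) (change_obj N) phi
    (rep_linear phi) (F_comm phi).

Definition change_functor : functor (rep_cat axX) (rep_cat axY).
Proof.
by apply: (@Functor (rep_cat axX) (rep_cat axY) change_obj change_mor) => *;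
  apply: rep_homP.
Defined.
End ChangeOfAction.

Notation admissible_rep S := (rep (@admissible _ _ S)).
Notation lr_rep L := (rep (@lr_representation _ _ L)).
Notation ARep_cat S := (rep_cat (@admissible _ _ S)).
Notation Rep_cat L := (rep_cat (@lr_representation _ _ L)).

(* Main.v *)
Require Import Defs.
From mathcomp Require Import all_boot all_algebra.

Set Implicit Arguments.
Unset Strict Implicit.
Unset Printing Implicit Defensive.

Import GRing.Theory.
Local Open Scope ring_scope.

(* Both functors keep the underlying A-module and the underlying maps, so it is
   enough that the two changes of action are mutually inverse: the unit and
   counit are then identity maps.  They are inverse because
   rho-bar (x (x) 1) = 1 rho x, and because an A-linear action of S (x) A is
   determined by x |-> rho (x (x) 1), as x (x) a = a (x (x) 1).  That rho-bar
   preserves brackets and satisfies the Leibniz rule is checked on pure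
   tensors; rho-tilde preserves brackets since derivations kill 1. *)

Section ChangeOfActionInverse.
Variables (A : comPzRingType) (X Y : Type).
Variable axX : forall M : lmodType A, (X -> M -> M) -> Prop.
Variable axY : forall M : lmodType A, (Y -> M -> M) -> Prop.
Variable F : forall M : rep axX, Y -> M -> M.
Hypothesis F_ax : forall M, axY (F (M := M)).
Hypothesis F_comm : forall (M N : rep axX) (phi : rep_hom M N) y m,
  phi (F y m) = F y (phi m).
Variable G : forall M : rep axY, X -> M -> M.
Hypothesis G_ax : forall M, axX (G (M := M)).
Hypothesis G_comm : forall (M N : rep axY) (phi : rep_hom M N) x m,
  phi (G x m) = G x (phi m).

(** Stated for one composite with both axiom systems abstract, so that swapping the roles of [F] and
    [G] yields the other half of an equivalence. *)
Lemma change_functor_comp_id :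
    (forall (M : rep axX) x m, @G (change_obj F_ax M) x m = rep_act x m) ->
  naturally_isomorphic
    (functor_comp (change_functor G_ax G_comm) (change_functor F_ax F_comm))
    (functor_id (rep_cat axX)).
Proof.
move=> GF; pose GFM (M : rep axX) := change_obj G_ax (change_obj F_ax M).
(* The actions on [GFM M] and [M] agree only pointwise, so the identity map is packaged as a
   morphism in each direction, with [GF] as its compatibility with the actions. *)
pose eta (M : rep axX) := @RepHom A X axX (GFM M) M id
  (fun _ _ _ => erefl) (GF M).
pose eta' (M : rep axX) := @RepHom A X axX M (GFM M) id
  (fun _ _ _ => erefl) (fun x m => esym (GF M x m)).
exists eta; split=> [M N f|M]; first exact: rep_homP.
by exists (eta' M); split; apply: rep_homP.
Qed.
End ChangeOfActionInverse.

Lemma derivation1 (K : comPzRingType) (A : comAlg K) (d : A -> A) :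
  derivation d -> d 1 = 0.
Proof.
move=> dd; apply: (addrI (d 1)); rewrite addr0.
by have := der_mul dd 1 1; rewrite !mulr1 mul1r.
Qed.

Section Bar.
Variables (K : comPzRingType) (A : comAlg K) (S : leibnizPair A).
Variables (M : lmodType A) (rho : S -> M -> M).
Hypothesis rho_adm : admissible rho.

Let rhoL x : linear (rho x : restr M -> restr M) := gl_hom_end (adm_gl rho_adm) x.
Let rhoD x m n : rho x (m + n) = rho x m + rho x n.
Proof. exact: (linear_fD (rhoL x)). Qed.
Let rho0 x : rho x 0 = 0.
Proof. exact: (linear_f0 (rhoL x)). Qed.
Let rhoZ x (k : K) m : rho x (alg_map A k *: m) = alg_map A k *: rho x m.
Proof. exact: (linear_fZ (rhoL x)). Qed.
Let rhoDl x y m : rho (x + y) m = rho x m + rho y m.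
Proof.
have := gl_hom_linear (adm_gl rho_adm) 1 x y m.
by rewrite scale1r => ->; rewrite [1 *: _]scale1r.
Qed.
Let rho0l m : rho 0 m = 0.
Proof. by apply: (addrI (rho 0 m)); rewrite -rhoDl !addr0. Qed.
Let rhoZl (k : K) x m : rho (k *: x) m = alg_map A k *: rho x m.
Proof.
have := gl_hom_linear (adm_gl rho_adm) k x 0 m.
by rewrite addr0 rho0l [_ + 0]addr0.
Qed.

(** This is rho-bar. [act_lift] sums over a chosen representative of [u]; [fDl], [fDr] and [fZ] make
    the result independent of that choice. *)
Definition bar_act (u : act_mod S) (m : M) : M :=
  act_lift (fun x a => a *: rho x m) u.

Let fDl m x y a : a *: rho (x + y) m = a *: rho x m + a *: rho y m.
Proof. by rewrite rhoDl scalerDr. Qed.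
Let fDr m x a b : (a + b) *: rho x m = a *: rho x m + b *: rho x m.
Proof. exact: scalerDl. Qed.
Let fZ m (k : K) x a : a *: rho (k *: x) m = (alg_map A k * a) *: rho x m.
Proof. by rewrite rhoZl scalerA mulrC. Qed.

Lemma bar_act_tens x a m : bar_act (act_tens x a) m = a *: rho x m.
Proof. exact: (act_lift_tens (fDl m) (fDr m) (fZ m)). Qed.

Lemma bar_actDl u v m : bar_act (u + v) m = bar_act u m + bar_act v m.
Proof. exact: (act_liftD (fDl m) (fDr m) (fZ m)). Qed.

Lemma bar_act0l m : bar_act 0 m = 0.
Proof. by apply: (addrI (bar_act 0 m)); rewrite -bar_actDl !addr0. Qed.

Lemma bar_actNl u m : bar_act (- u) m = - bar_act u m.
Proof. by apply/eqP; rewrite -addr_eq0 -bar_actDl addNr bar_act0l. Qed.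

Lemma bar_actZl a u m : bar_act (a *: u) m = a *: bar_act u m.
Proof.
elim/act_ind: u => [|x b|u v IHu IHv]; first by rewrite !(scaler0, bar_act0l).
- by rewrite act_tensZr !bar_act_tens scalerA.
- by rewrite scalerDr !bar_actDl IHu IHv scalerDr.
Qed.

Lemma bar_actD u m n : bar_act u (m + n) = bar_act u m + bar_act u n.
Proof.
elim/act_ind: u => [|x b|u v IHu IHv]; first by rewrite !bar_act0l addr0.
- by rewrite !bar_act_tens rhoD scalerDr.
- by rewrite !bar_actDl IHu IHv addrACA.
Qed.

Lemma bar_act0 u : bar_act u 0 = 0.
Proof. by apply: (addrI (bar_act u 0)); rewrite -bar_actD !addr0. Qed.

(** Scalars from [K] pass through [rho x] because it is [K]-linear; a general element of [A] costs
    an anchor term, as in [bar_act_leibniz]. *)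
Lemma bar_actZ u (k : K) m :
  bar_act u (alg_map A k *: m) = alg_map A k *: bar_act u m.
Proof.
elim/act_ind: u => [|x b|u v IHu IHv]; first by rewrite !bar_act0l scaler0.
- by rewrite !bar_act_tens rhoZ !scalerA mulrC.
- by rewrite !bar_actDl IHu IHv scalerDr.
Qed.

(** Every term is additive in [u]. For [u] = x (x) b the identity is b times the Leibniz rule of
    [rho x], since the anchor of x (x) b is b beta(x) and [A] is commutative. *)
Lemma bar_act_leibniz (u : actionLR S) a m :
  bar_act u (a *: m) = a *: bar_act u m + lr_anchor u a *: m.
Proof.
have ancD (v w : actionLR S) : lr_anchor (v + w) a = lr_anchor v a + lr_anchor w a.
  by have := lr_anchor_linear 1 v w a; rewrite scale1r mul1r.
have anc0 : lr_anchor (0 : actionLR S) a = 0.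
  by apply: (addrI (lr_anchor (0 : actionLR S) a)); rewrite -ancD !addr0.
elim/act_ind: u => [|x b|u v IHu IHv].
- by rewrite anc0 !bar_act0l scaler0 scale0r addr0.
- rewrite [lr_anchor _ _]act_anchorE !bar_act_tens (adm_leibniz rho_adm).
  by rewrite scalerDr !scalerA mulrC.
- by rewrite !bar_actDl IHu IHv ancD scalerDr scalerDl addrACA.
Qed.

(** By biadditivity pure tensors suffice. *)
Lemma bar_act_bracket (u v : actionLR S) m :
  bar_act (lr_bracket u v) m =
    bar_act u (bar_act v m) - bar_act v (bar_act u m).
Proof.
have lie := lr_lie (actionLR S).
elim/act_ind: u => [|x a|u u' IHu IHu'].
- rewrite [lr_bracket _ _](linear_f0 (lie_linearl lie v)).
  by rewrite !bar_act0l bar_act0 subr0.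
- elim/act_ind: v => [|y b|v v' IHv IHv'].
  + rewrite [lr_bracket _ _](linear_f0 (lie_linearr lie _)).
    by rewrite !bar_act0l bar_act0 subr0.
  + rewrite [lr_bracket _ _]act_bracketE !(bar_actDl, bar_actNl, bar_act_tens).
    (* Moving [rho x] past b and [rho y] past a creates the terms a beta(x)(b) rho(y) m and b
       beta(y)(a) rho(x) m, which match the last two terms of the action bracket; the rest is ab
       times the commutator of [rho x] and [rho y]. *)
    rewrite !(adm_leibniz rho_adm) !scalerDr !scalerA.
    rewrite [rho (lp_bracket x y) m](gl_hom_bracket (adm_gl rho_adm)).
    rewrite [_ *: (_ - _)]scalerBr (mulrC b a) opprD addrACA -!addrA.
    by congr (_ + _); rewrite addrCA.
  + rewrite [lr_bracket _ _](linear_fD (lie_linearr lie _)).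
    by rewrite !bar_actDl bar_actD opprD IHv IHv' addrACA.
- rewrite [lr_bracket _ _](linear_fD (lie_linearl lie _)).
  by rewrite !bar_actDl bar_actD opprD IHu IHu' addrACA.
Qed.

Lemma bar_act_representation :
  lr_representation (bar_act : actionLR S -> M -> M).
Proof.
split=> [|a u v m|u a m]; last exact: bar_act_leibniz.
  split=> [u k m n|k u v m|u v m]; last exact: bar_act_bracket.
  - by rewrite bar_actD; congr (_ + _); apply: bar_actZ.
  (* [K] acts on both modules through [alg_map A], so this is a case of [A]-linearity. *)
  - by rewrite bar_actDl; congr (_ + _); apply: bar_actZl.
by rewrite bar_actDl bar_actZl.
Qed.
End Bar.

Lemma bar_act_comm (K : comPzRingType) (A : comAlg K) (S : leibnizPair A)
    (V W : admissible_rep S) (phi : rep_hom V W) u m :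
  phi (bar_act (@rep_act _ _ _ V) u m) =
    bar_act (@rep_act _ _ _ W) u (phi m).
Proof.
have phil := rep_linear phi; have [aV aW] := (rep_ax V, rep_ax W).
elim/act_ind: u => [|x a|u v IHu IHv].
- by rewrite !bar_act0l // (linear_f0 phil).
- by rewrite !bar_act_tens // (linear_fZ phil) rep_comm.
- by rewrite !bar_actDl // (linear_fD phil) IHu IHv.
Qed.

Section Tilde.
Variables (K : comPzRingType) (A : comAlg K) (S : leibnizPair A).
Variables (M : lmodType A) (rho : actionLR S -> M -> M).
Hypothesis rho_rep : lr_representation rho.

Definition tilde_act (x : S) (m : M) : M := rho (act_tens x 1) m.

Lemma tilde_act_admissible : admissible tilde_act.
Proof.
have [rhoE rhoL rhoM] := rho_rep.
split=> [|x a m]; last first.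
  by rewrite /tilde_act rhoM [lr_anchor _ _]act_anchorE mul1r.
split=> [x|k x y m|x y m]; first exact: (gl_hom_end rhoE).
(* Since kx (x) 1 = x (x) k1 = k(x (x) 1), the scalar leaves by the [A]-linearity of [rho]. *)
- by rewrite /tilde_act act_tensDl act_tensZ -act_tensZr rhoL.
(* The commutator is folded back into [rho] of the bracket of x (x) 1 and y (x) 1, whose two anchor
   terms contain beta(x)(1) and beta(y)(1). *)
- rewrite /tilde_act -[RHS](gl_hom_bracket rhoE) [lr_bracket _ _]act_bracketE.
  have anchor1 z : lp_anchor z 1 = 0 := derivation1 (der_hom_der (lp_der S) z).
  by rewrite !anchor1 !mulr0 !act_tens0r subr0 addr0 mulr1.
Qed.

Lemma bar_tilde_act u m : bar_act tilde_act u m = rho u m.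
Proof.
have adm := tilde_act_admissible; have [_ rhoL _] := rho_rep.
have rhoD (v w : actionLR S) : rho (v + w) m = rho v m + rho w m.
  by have := rhoL 1 v w m; rewrite !scale1r.
have rho0 : rho 0 m = 0 by apply: (addrI (rho 0 m)); rewrite -rhoD !addr0.
elim/act_ind: u => [|x a|u v IHu IHv]; first by rewrite bar_act0l.
(* The summand 0 isolates the scaling rule for a(x (x) 1) = x (x) a. *)
- have := rhoL a (act_tens x 1) 0 m.
  by rewrite rho0 !addr0 bar_act_tens // [_ *: act_tens _ _]act_tensZr mulr1.
- by rewrite bar_actDl // IHu IHv rhoD.
Qed.
End Tilde.

Lemma tilde_bar_act (K : comPzRingType) (A : comAlg K) (S : leibnizPair A)
    (M : lmodType A) (rho : S -> M -> M) :
  admissible rho -> forall x m, tilde_act (bar_act rho) x m = rho x m.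
Proof. by move=> adm x m; rewrite /tilde_act bar_act_tens // scale1r. Qed.

Theorem mainTheorem9 (K : closedFieldType) (charK : [pchar K] =i pred0)
    (A : comAlg K) (S : leibnizPair A) :
  exists (bar : forall V : admissible_rep S, actionLR S -> V -> V)
         (bar_rep : forall V, lr_representation (bar V))
         (bar_comm : forall (V W : admissible_rep S) (phi : rep_hom V W) u m,
            phi (bar V u m) = bar W u (phi m))
         (til : forall V : lr_rep (actionLR S), S -> V -> V)
         (til_adm : forall V, admissible (til V))
         (til_comm : forall (V W : lr_rep (actionLR S)) (phi : rep_hom V W) x m,
            phi (til V x m) = til W x (phi m)),
    [/\ forall (V : admissible_rep S) (x : S) (a : A) (m : V),
          bar V (act_tens x a) m = a *: rep_act x m,
        forall (V : lr_rep (actionLR S)) (x : S) (m : V),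
          til V x m = rep_act (act_tens x 1 : actionLR S) m
      & @equivalence (ARep_cat S) (Rep_cat (actionLR S))
          (change_functor bar_rep bar_comm) (change_functor til_adm til_comm)].
Proof.
exists (fun V => bar_act (@rep_act _ _ _ V)).
exists (fun V => bar_act_representation (rep_ax V)).
exists (@bar_act_comm K A S).
exists (fun V => tilde_act (@rep_act _ _ _ V)).
exists (fun V => tilde_act_admissible (rep_ax V)).
(* Commuting with rho-tilde of x is commuting with the element x (x) 1. *)
exists (fun V W phi x => rep_comm phi (act_tens x 1)).
split=> [V x a m|//|]; first exact: (bar_act_tens (rep_ax V)).
split; apply: change_functor_comp_id => V x m /=.
- exact: (tilde_bar_act (rep_ax V)).
- exact: (bar_tilde_act (rep_ax V)).
Qed.
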